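(* For each finite cubic lattice $\Lambda\subset\mathbb{Z}^d$ (with periodic boundary conditions) let $\mathcal{L}^\Lambda=\sum_{x\in\Lambda}\mathcal{L}^\Lambda_x$ be a Liouvillian, forming a sequence of strictly local, uniformly bounded Liouvillians, and let $\omega_\Lambda$ be a sequence of states such that $\mathcal{L}^\Lambda$ is reversible with respect to $\omega_\Lambda$ for every $\Lambda$. Let $O_\Lambda=\sum_{x\in\Lambda}O_{\{x\}}$ be a self-adjoint extensive quantity, and suppose there is a constant $\mu>0$, independent of $\Lambda$, such that $$\omega_\Lambda\big(O_\Lambda^2\big)\ \geq\ \Big(\tfrac12\mu|\Lambda|\Big)^2\quad\text{for all }\Lambda .$$ Define $$\tilde O^{\pm}_\Lambda:=\frac{1}{\sqrt2}\left(\mathbf 1\pm\frac{O_\Lambda}{\omega_\Lambda(O_\Lambda^2)^{1/2}}\right),\qquad \omega^{\pm}_\Lambda(A):=\omega_\Lambda\big(\tilde O^{\pm}_\Lambda A\,\tilde O^{\pm}_\Lambda\big).$$ Then the sequences $\omega^{+}_\Lambda$ and $\omega^-_\Lambda$ are asymptotically reversible, i.e. $$\lim_{\Lambda\nearrow\mathbb{Z}^d}\big|\omega^\pm_\Lambda(\mathcal{L}^\Lambda[A]\,B)-\omega^\pm_\Lambda(A\,\mathcal{L}^\Lambda[B])\big|=0$$ for any two local operators $A,B$, and thus metastable, i.e. $\lim_{\Lambda\nearrow\mathbb{Z}^d}|\omega^\pm_\Lambda(\mathcal{L}^\Lambda[A])|=0$ for every local operator $A$.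
   Context: Setting: $\Lambda\subset\mathbb{Z}^d$ ranges over cubes of side length $L$ (volume $|\Lambda|=L^d$) with periodic boundary conditions; $\Lambda\nearrow\mathbb{Z}^d$ means $L\to\infty$ along cubes exhausting $\mathbb{Z}^d$. To each site $x$ a finite-dimensional Hilbert space $\mathcal{H}_x$ is attached (a regular lattice system, with fixed local dimension), and $\mathcal{H}_\Lambda=\bigotimes_{x\in\Lambda}\mathcal{H}_x$. A local operator is an operator with fixed finite support (independent of $\Lambda$), viewed as an operator on $\mathcal{H}_\Lambda$ for all large $\Lambda$. A state is written as $\omega(A)=\mathrm{Tr}(\rho_\omega A)$ with $\rho_\omega$ a density matrix. Liouvillians (Heisenberg picture): $\mathcal{L}^\Lambda=\sum_{x\in\Lambda}\mathcal{L}^\Lambda_x$ with $$\mathcal{L}^\Lambda_x[A]=\mathrm{i}[H_x,A]+\sum_i\Big(L_x^iA(L_x^i)^\dagger-\tfrac12\{L_x^i(L_x^i)^\dagger,A\}\Big).$$ Strictly local: there is a fixed $r$ (independent of $x,\Lambda$) such that all $H_x$ (self-adjoint) and $L^i_x$ are supported in the ball $B_r(x)$. Uniformly bounded: $\|\mathcal{L}^\Lambda_x[A]\|\le b\|A\|$ for all $A$, with $b>0$ independent of $x$ and $\Lambda$. Reversible (detailed balance): $\mathcal{L}^\Lambda$ is reversible with respect to $\omega_\Lambda$ if $\omega_\Lambda(A\,\mathcal{L}^\Lambda[B])=\omega_\Lambda(\mathcal{L}^\Lambda[A]\,B)$ for all operators $A,B$ on $\mathcal{H}_\Lambda$. Extensive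 quantity: an operator $O_\Lambda=\sum_{x\in\Lambda}O_{\{x\}}$ where each $O_{\{x\}}$ is supported in a ball of fixed radius around $x$ and $\|O_{\{x\}}\|\le o$ with $o$ independent of $x$ and $\Lambda$. No symmetry assumption is made, so $\omega_\Lambda^\pm$ are positive functionals (they are normalized states when $\omega_\Lambda(O_\Lambda)=0$). *)

(* Defs.v *)
From HB Require Import structures.
From mathcomp Require Import all_boot all_order all_algebra.
From mathcomp Require Import finmap.
From mathcomp Require Import all_classical all_reals topology normedtype.
From mathcomp Require Import complex.

Set Implicit Arguments.
Unset Strict Implicit.
Unset Printing Implicit Defensive.

Import Order.TTheory GRing.Theory Num.Theory.
Import numFieldNormedType.Exports.

Local Open Scope classical_set_scope.
Local Open Scope sesquilinear_scope.
Local Open Scope complex_scope.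
Local Open Scope ring_scope.

Notation Zd d := {ffun 'I_d -> int}.

(* The cube \prod_i [corner i, corner i + side) of Z^d. *)
Record cube (d : nat) : Type := Cube {
  corner : Zd d;
  side : nat;
  side_gt0 : (0 < side)%N
}.

(* Sites are named by their position relative to the corner, i.e. the site s
   is the point of Z^d with coordinates corner i + s i. *)
Definition site d (Lam : cube d) : finType := {ffun 'I_d -> 'I_(side Lam)}.

Definition in_cube d (Lam : cube d) (x : Zd d) : bool :=
  [forall i, (corner Lam i <= x i) && (x i < corner Lam i + (side Lam)%:Z)].

(* The reduction modulo the periods: injective on the cube, where it is the
   identification of points of Z^d with sites. *)
Definition to_site d (Lam : cube d) (x : Zd d) : site Lam :=
  [ffun i => Ordinal (ltn_pmod
     `|((x i - corner Lam i) %% (side Lam)%:Z)%Z|%N (side_gt0 Lam))].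

(* Graph distance of the discrete torus (nearest-neighbour edges). *)
Definition torus_dist d (Lam : cube d) (x y : site Lam) : nat :=
  (\sum_(i < d) let k := (x i - y i) + (y i - x i) in
                minn k (side Lam - k))%N.

Definition ball_site d (Lam : cube d) (x : site Lam) (r : nat) :
    {set site Lam} :=
  [set y | (torus_dist x y <= r)%N]%SET.

(* The filter "Lambda -> Z^d": a property holds eventually if it holds for all
   cubes containing some finite subset of Z^d. *)
Definition to_Zd (d : nat) : set_system (cube d) :=
  filter_from setT (fun X : {fset Zd d} =>
    [set Lam | forall x, x \in X -> in_cube Lam x]).

Arguments to_Zd : clear implicits.

Lemma finite_in_cube d (X : {fset Zd d}) :
  exists Lam : cube d, forall x, x \in X -> in_cube Lam x.
Proof.
pose n := (\max_(x <- enum_fset X) \max_(i < d) `|x i|%N)%N.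
exists (@Cube d [ffun=> - n%:Z] (n.*2.+1) isT) => x xX.
apply/forallP => i; rewrite ffunE /=.
have le_n : (`|x i| <= n)%N.
  apply: leq_trans (leq_bigmax_seq _ xX isT).
  exact: (leq_bigmax (F := fun i => `|x i|%N)).
have : `|x i| <= n%:Z by rewrite -abszE lez_nat.
rewrite ler_norml => /andP[-> /= xin].
apply: le_lt_trans xin _.
by rewrite -addnn -addSn PoszD addrC addrK ltz_nat.
Qed.

#[global] Instance to_Zd_proper_filter d : ProperFilter (to_Zd d).
Proof.
apply: filter_from_proper; last first.
  by move=> X _; have [Lam h] := finite_in_cube X; exists Lam.
apply: filter_from_filter; first by exists fset0.
move=> X Y _ _; exists (X `|` Y)%fset => // Lam h.
by split=> x xX; apply: h; rewrite in_fsetE xX ?orbT.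
Qed.

(* Operators on the tensor product (C^q)^{\otimes S}, in the product basis,
   which is indexed by the configurations S -> 'I_q. *)
Notation op R q S := 'M[R[i]]_#|{: {ffun S -> 'I_q}}|.

Section Operators.
Variables (R : realType) (q : nat).
Implicit Types S T : finType.

Local Notation op S := (op R q S).
Local Notation config S := {ffun S -> 'I_q}.

(* For injective f, lift_op f a is a \otimes 1: a acts on the tensor factors
   f(T), the identity acts on the others. *)
Definition lift_op T S (f : T -> S) (a : op T) : op S :=
  \matrix_(i, j)
    let u : config S := enum_val i in let v : config S := enum_val j in
    if [forall y, (y \notin codom f) ==> (u y == v y)]
    then a (enum_rank ([ffun x => u (f x)] : config T))
           (enum_rank ([ffun x => v (f x)] : config T))
    else 0.

Definition supported S (B : {set S}) (A : op S) : Prop :=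
  exists a : op {x : S | x \in B}, A = lift_op val a.

(* The operator a of finite support X, on H_Lambda; only meaningful if the
   cube contains X. *)
Definition local_op d (X : {fset Zd d}) (a : op X) (Lam : cube d) :
    op (site Lam) :=
  lift_op (fun x : X => to_site Lam (val x)) a.

Definition vnorm n (v : 'cV[R[i]]_n) : R :=
  Num.sqrt (\sum_i Normc.normc (v i ord0) ^+ 2).

Definition opnorm S (A : op S) : R :=
  sup [set vnorm (A *m v) | v in [set v | vnorm v <= 1]].

Definition density S (rho : op S) : Prop :=
  [/\ rho ^t* = rho,
      forall v : 'cV[R[i]]_#|{: config S}|, 0 <= (v ^t* *m rho *m v) ord0 ord0
    & \tr rho = 1].

(* The expectation of A in the state with density matrix rho. *)
Definition state S (rho A : op S) : R[i] := \tr (rho *m A).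

Definition comm S (A B : op S) : op S := A *m B - B *m A.
Definition acomm S (A B : op S) : op S := A *m B + B *m A.

Record lindblad S : Type := Lindblad {
  ham : op S;
  jumps : seq (op S);
  ham_sa : ham ^t* = ham
}.

(* Heisenberg picture, with the convention A |-> L A L^dagger for the jumps. *)
Definition lindblad_map S (G : lindblad S) (A : op S) : op S :=
  'i *: comm (ham G) A
  + \sum_(L <- jumps G) (L *m A *m L ^t* - 2^-1 *: acomm (L *m L ^t*) A).

Definition reversible S (Liou : op S -> op S) (phi : op S -> R[i]) : Prop :=
  forall A B : op S, phi (A *m Liou B) = phi (Liou A *m B).

(* s = 1 and s = -1 give the two signs. *)
Definition tilde_op S (rho O : op S) (s : R[i]) : op S :=
  (sqrtC 2)^-1 *: (1%:M + (s / sqrtC (state rho (O *m O))) *: O).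

Definition tilde_state S (rho O : op S) (s : R[i]) (A : op S) : R[i] :=
  state rho (tilde_op rho O s *m A *m tilde_op rho O s).

Section Families.
Variable d : nat.

Definition liouvillian (G : forall Lam : cube d, site Lam -> lindblad (site Lam))
    (Lam : cube d) (A : op (site Lam)) : op (site Lam) :=
  \sum_(x : site Lam) lindblad_map (G Lam x) A.

Definition strictly_local
    (G : forall Lam : cube d, site Lam -> lindblad (site Lam)) : Prop :=
  exists r : nat, forall (Lam : cube d) (x : site Lam),
    supported (ball_site x r) (ham (G Lam x)) /\
    forall L, L \in jumps (G Lam x) -> supported (ball_site x r) L.

Definition uniformly_bounded
    (G : forall Lam : cube d, site Lam -> lindblad (site Lam)) : Prop :=
  exists2 b : R, 0 < b &
    forall (Lam : cube d) (x : site Lam) (A : op (site Lam)),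
      opnorm (lindblad_map (G Lam x) A) <= b * opnorm A.

Definition extensive (o : forall Lam : cube d, site Lam -> op (site Lam)) :
    Prop :=
  exists (r : nat) (c : R), forall (Lam : cube d) (x : site Lam),
    supported (ball_site x r) (o Lam x) /\ opnorm (o Lam x) <= c.

Definition extensive_sum (o : forall Lam : cube d, site Lam -> op (site Lam))
    (Lam : cube d) : op (site Lam) :=
  \sum_(x : site Lam) o Lam x.

Definition asymptotically_reversible
    (Liou : forall Lam : cube d, op (site Lam) -> op (site Lam))
    (phi : forall Lam : cube d, op (site Lam) -> R[i]) : Prop :=
  forall (X Y : {fset Zd d}) (a : op X) (b : op Y),
    Normc.normc (phi Lam (Liou Lam (local_op a Lam) *m local_op b Lam)
               - phi Lam (local_op a Lam *m Liou Lam (local_op b Lam)))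
      @[Lam --> to_Zd d] --> (0 : R).

Definition metastable
    (Liou : forall Lam : cube d, op (site Lam) -> op (site Lam))
    (phi : forall Lam : cube d, op (site Lam) -> R[i]) : Prop :=
  forall (X : {fset Zd d}) (a : op X),
    Normc.normc (phi Lam (Liou Lam (local_op a Lam)))
      @[Lam --> to_Zd d] --> (0 : R).

End Families.
End Operators.

Arguments liouvillian {R q d} G Lam A.

(* Main.v *)
(* The carre du champ G(X, Y) = L(XY) - L(X) Y - X L(Y) is a sum over x of terms
   that are O(1) in norm and only see the parts of X and Y near x. Since L 1 = 0,
   reversibility gives w(X L(Y)) = w(L(X) Y) = - w(G(X, Y)) / 2. Comparing both
   sides with w(L(TA) BT) = w(TA L(BT)), for T = tilde O, yields exactly
     w(T L(A) B T) - w(T A L(B) T) = w(G(T, ABT)) / 2 - w(G(T, A) BT)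
                                    - w(G(TAB, T)) / 2 + w(TA G(B, T)).
   Near any x, T is a scalar plus O(1/|Lambda|). So the boundedly many x near the
   supports of A and B contribute O(1/|Lambda|) each, and the others contribute
   only to the first and third terms, O(1/|Lambda|^2) each. *)

Require Import Defs.
From HB Require Import structures.
From mathcomp Require Import all_boot all_order all_algebra.
From mathcomp Require Import finmap.
From mathcomp Require Import all_classical all_reals topology normedtype.
From mathcomp Require Import complex.
From mathcomp Require Import spectral sesquilinear ring lra zify.

Set Implicit Arguments.
Unset Strict Implicit.
Unset Printing Implicit Defensive.

Import Order.TTheory GRing.Theory Num.Theory.
Import numFieldNormedType.Exports.

Local Open Scope classical_set_scope.
Local Open Scope sesquilinear_scope.
Local Open Scope complex_scope.
Local Open Scope ring_scope.

(** * Operator norm and states *)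

Section Norms.
Variable R : realType.
Local Notation C := R[i].
Local Notation normc := (@Normc.normc R).

Lemma normcE (z : C) : (normc z)%:C = `|z|.
Proof. by []. Qed.

Lemma normc_ge0 (z : C) : 0 <= normc z.
Proof. by rewrite -lecR normcE normr_ge0. Qed.

Lemma ler_normc_sum (I : finType) (P : pred I) (F : I -> C) :
  normc (\sum_(i | P i) F i) <= \sum_(i | P i) normc (F i).
Proof.
rewrite -lecR normcE rmorph_sum; apply: le_trans (ler_norm_sum _ _ _) _.
by rewrite lexx.
Qed.

Section Vectors.
Variable n : nat.
Implicit Types (u v : 'cV[C]_n) (M : 'M[C]_n).

Lemma vnorm_ge0 v : 0 <= vnorm v.
Proof. exact: sqrtr_ge0. Qed.

Lemma vnorm_sqr v : vnorm v ^+ 2 = \sum_i normc (v i ord0) ^+ 2.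
Proof. by rewrite /vnorm sqr_sqrtr // sumr_ge0 // => i _; rewrite sqr_ge0. Qed.

(** The form [dotmx] lives on row vectors, hence the transposes. This identification gives access to
    the triangle and Cauchy-Schwarz inequalities for [dotmx]. *)
Lemma vnorm_dotmx v : (vnorm v)%:C = sqrtC (dotmx v^T v^T).
Proof.
rewrite -[LHS]sqrCK; last by rewrite ler0c vnorm_ge0.
congr sqrtC; rewrite -rmorphXn vnorm_sqr rmorph_sum dotmxE mxE /=.
by apply: eq_bigr => i _; rewrite rmorphXn /= normcE normCK !mxE.
Qed.

Lemma vnormD u v : vnorm (u + v) <= vnorm u + vnorm v.
Proof.
rewrite -lecR rmorphD /= !vnorm_dotmx linearD.
exact: (triangle_lerif _ u^T v^T).1.
Qed.

Lemma vnormZ a v : vnorm (a *: v) = normc a * vnorm v.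
Proof.
rewrite /vnorm; under eq_bigr do rewrite mxE Normc.normcM exprMn.
by rewrite -mulr_sumr sqrtrM ?sqr_ge0 // sqrtr_sqr ger0_norm ?normc_ge0.
Qed.

Lemma vnorm0 : vnorm (0 : 'cV[C]_n) = 0.
Proof. by rewrite -(scale0r 0) vnormZ Normc.normc0 mul0r. Qed.

Lemma vnorm_eq0 v : vnorm v = 0 -> v = 0.
Proof.
move=> v0; have : \sum_i normc (v i ord0) ^+ 2 = 0 by rewrite -vnorm_sqr v0 expr0n.
move/eqP; rewrite psumr_eq0 => [/allP h|i _]; last by rewrite sqr_ge0.
apply/matrixP => i j; rewrite ord1 mxE; apply: Normc.eq0_normc.
by have := h i (mem_index_enum _); rewrite /= sqrf_eq0 => /eqP.
Qed.

Lemma normc_dot_le u v :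
  normc ((u ^t* *m v) ord0 ord0) <= vnorm u * vnorm v.
Proof.
rewrite -lecR rmorphM /= normcE !vnorm_dotmx mulrC.
have -> : (u ^t* *m v) ord0 ord0 = dotmx v^T u^T; last first.
  exact: (CauchySchwarz_sqrt (@dotmx C n) v^T u^T).1.
by rewrite dotmxE !mxE; apply: eq_bigr => i _; rewrite !mxE mulrC.
Qed.

(* Cauchy-Schwarz on each row, then exchange of the summations. *)
Lemma vnorm_sparse (e : rel 'I_n) (K : nat) (m : R) M v :
  symmetric e -> (forall i, (#|[pred j | e i j]| <= K)%N) -> 0 <= m ->
  (forall i j, ~~ e i j -> M i j = 0) -> (forall i j, normc (M i j) <= m) ->
  vnorm (M *m v) <= K%:R * m * vnorm v.
Proof.
move=> e_sym e_deg m0 M0 Mm.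
rewrite -ler_sqr ?nnegrE ?mulr_ge0 ?vnorm_ge0 ?ler0n //.
rewrite exprMn !vnorm_sqr.
have row i : normc ((M *m v) i ord0) ^+ 2 <=
    K%:R * m ^+ 2 * \sum_(j | e i j) normc (v j ord0) ^+ 2.
  have le1 : normc ((M *m v) i ord0) <= m * \sum_(j | e i j) normc (v j ord0).
    rewrite mxE (bigID (e i)) /= [X in _ + X]big1 ?addr0; last first.
      by move=> j /M0 ->; rewrite mul0r.
    apply: le_trans (ler_normc_sum _ _) _; rewrite mulr_sumr; apply: ler_sum.
    by move=> j _; rewrite Normc.normcM ler_wpM2r ?normc_ge0.
  have sum0 : 0 <= \sum_(j | e i j) normc (v j ord0).
    by apply: sumr_ge0 => j _; rewrite normc_ge0.
  apply: (@le_trans _ _ ((m * \sum_(j | e i j) normc (v j ord0)) ^+ 2)).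
    by rewrite ler_sqr ?nnegrE ?normc_ge0 ?mulr_ge0.
  rewrite exprMn [K%:R * _]mulrC -[leRHS]mulrA.
  apply: ler_wpM2l; first exact: sqr_ge0.
  set x := fun j => normc (v j ord0).
  (* Cauchy-Schwarz in elementary form: the square of the sum is expanded and each product
     [x j * x k] is bounded by the mean of the two squares. *)
  apply: (@le_trans _ _ (\sum_(j | e i j) \sum_(k | e i k) 2^-1 * (x j ^+ 2 + x k ^+ 2))).
    rewrite expr2 mulr_suml; apply: ler_sum => j _; rewrite mulr_sumr.
    apply: ler_sum => k _; have := sqr_ge0 (x j - x k); rewrite -/(x j) -/(x k); nra.
  have -> : \sum_(j | e i j) \sum_(k | e i k) 2^-1 * (x j ^+ 2 + x k ^+ 2) =
            #|[pred j | e i j]|%:R * \sum_(j | e i j) x j ^+ 2.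
    under eq_bigr do rewrite -mulr_sumr big_split /= sumr_const.
    rewrite -mulr_sumr big_split /= sumr_const.
    rewrite [RHS]mulr_natl sumrMnl -mulr2n -[X in _ * X]mulr_natl mulrA mulVf ?mul1r //.
    by rewrite pnatr_eq0.
  by rewrite ler_wpM2r ?ler_nat // sumr_ge0 // => j _; rewrite sqr_ge0.
apply: le_trans (ler_sum _ (fun i _ => row i)) _.
rewrite -mulr_sumr exprMn.
have -> : K%:R ^+ 2 * m ^+ 2 * \sum_i normc (v i ord0) ^+ 2 =
          K%:R * m ^+ 2 * (K%:R * \sum_i normc (v i ord0) ^+ 2).
  by ring.
apply: ler_wpM2l; first by rewrite mulr_ge0 ?sqr_ge0.
rewrite mulr_sumr.
(* After the exchange, the term of [j] is counted once for each [i] related to it, hence at most [K]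
   times by symmetry of [e]. *)
rewrite (exchange_big_dep predT) //=; apply: ler_sum => j _.
rewrite sumr_const -[leLHS]mulr_natl ler_wpM2r ?sqr_ge0 // ler_nat.
by apply: leq_trans (e_deg j); apply: eq_leq; apply: eq_card => i; rewrite !inE e_sym.
Qed.

End Vectors.
End Norms.

Section Opnorm.
Variables (R : realType) (q : nat) (S : finType).
Local Notation C := R[i].
Local Notation normc := (@Normc.normc R).
Local Notation op := (op R q S).
Implicit Types (A B : op) (v : 'cV[C]_#|{: {ffun S -> 'I_q}}|).

Lemma opnorm_le A K :
  (forall v, vnorm (A *m v) <= K * vnorm v) -> 0 <= K -> opnorm A <= K.
Proof.
move=> AK K0; apply: ge_sup.
  by exists (vnorm (A *m 0)), 0 => //=; rewrite vnorm0.
move=> _ [v /= v1 <-]; apply: le_trans (AK v) _.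
by rewrite ler_piMr.
Qed.

(** A [sup] bounds its set only if that set is bounded above. A crude bound by the sum of all
    entries, from [vnorm_sparse] with the full relation, settles this; rescaling [v] to the unit
    ball does the rest. *)
Lemma vnorm_mulmx A v : vnorm (A *m v) <= opnorm A * vnorm v.
Proof.
have sup_le w : vnorm w <= 1 -> vnorm (A *m w) <= opnorm A.
  move=> w1; apply: sup_upper_bound; last by exists w.
  split; first by exists (vnorm (A *m w)), w.
  pose m := \sum_i \sum_j normc (A i j).
  have m0 : 0 <= m by do 2!apply: sumr_ge0 => ? _; rewrite normc_ge0.
  set N := #|{: {ffun S -> 'I_q}}| in A w w1 m m0 *.
  exists (N%:R * m) => _ [u /= u1 <-].
  have Am i j : normc (A i j) <= m.
    rewrite /m (bigD1 i) //= (bigD1 j) //= -addrA lerDl addr_ge0 //.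
      by apply: sumr_ge0 => ? _; rewrite normc_ge0.
    by do 2!apply: sumr_ge0 => ? _; rewrite normc_ge0.
  have deg (i : 'I_N) : (#|[pred j : 'I_N | predT j]| <= N)%N.
    by apply: leq_trans (max_card _) _; rewrite card_ord.
  have := @vnorm_sparse R _ (fun _ => predT) N m A u (fun _ _ => erefl) deg m0.
  move=> /(_ _ Am)/le_trans; apply => //.
  by rewrite ler_piMr // mulr_ge0.
have [v0|v0] := eqVneq (vnorm v) 0.
  by rewrite v0 mulr0 (vnorm_eq0 v0) mulmx0 vnorm0.
have v_gt0 : 0 < vnorm v by rewrite lt_def v0 vnorm_ge0.
have nrm : normc ((vnorm v)^-1%:C) = (vnorm v)^-1.
  by apply: (@complexI R); rewrite normcE ger0_norm // ler0c invr_ge0 ltW.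
have := sup_le ((vnorm v)^-1%:C *: v).
rewrite -scalemxAr !vnormZ nrm mulVf // lexx => /(_ isT).
by rewrite mulrC ler_pdivrMr.
Qed.

Lemma opnorm_ge0 A : 0 <= opnorm A.
Proof.
have [[v] | h] := pselect (exists v : 'cV[C]_#|{: {ffun S -> 'I_q}}|, v != 0).
  move=> v_neq0; have := le_trans (vnorm_ge0 _) (vnorm_mulmx A v).
  by rewrite pmulr_lge0 // lt_def vnorm_ge0 andbT; apply: contra v_neq0 => /eqP/vnorm_eq0->.
(* The remaining case is a zero-dimensional space ([q = 0] and [S] nonempty), where the supremum is
   over the singleton 0. *)
have A0 v : vnorm (A *m v) = 0.
  have [->|v0] := eqVneq v 0; first by rewrite mulmx0 vnorm0.
  by case: h; exists v.
rewrite /opnorm (_ : [set _ | _ in _] = [set 0]) ?sup1 //.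
apply/seteqP; split=> [_ [v _ <-] /= | _ ->]; first exact: A0.
by exists 0 => /=; rewrite ?mulmx0 vnorm0.
Qed.

Lemma opnormD A B : opnorm (A + B) <= opnorm A + opnorm B.
Proof.
apply: opnorm_le => [v|]; last by rewrite addr_ge0 ?opnorm_ge0.
rewrite mulmxDl mulrDl; apply: le_trans (vnormD _ _) _.
by rewrite lerD ?vnorm_mulmx.
Qed.

Lemma opnormM A B : opnorm (A *m B) <= opnorm A * opnorm B.
Proof.
apply: opnorm_le => [v|]; last by rewrite mulr_ge0 ?opnorm_ge0.
rewrite -mulmxA; apply: le_trans (vnorm_mulmx _ _) _.
by rewrite -mulrA ler_wpM2l ?opnorm_ge0 ?vnorm_mulmx.
Qed.

Lemma opnormZ_le a A : opnorm (a *: A) <= normc a * opnorm A.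
Proof.
apply: opnorm_le => [v|]; last by rewrite mulr_ge0 ?opnorm_ge0 ?normc_ge0.
by rewrite -scalemxAl vnormZ -mulrA ler_wpM2l ?normc_ge0 ?vnorm_mulmx.
Qed.

Lemma opnormN A : opnorm (- A) <= opnorm A.
Proof.
rewrite -scaleN1r; apply: le_trans (opnormZ_le _ _) _.
suff -> : normc (-1) = 1 by rewrite mul1r.
by apply: (@complexI R); rewrite normcE normrN1.
Qed.

Lemma opnormB A B : opnorm (A - B) <= opnorm A + opnorm B.
Proof. by apply: le_trans (opnormD _ _) _; rewrite lerD2l opnormN. Qed.

(** Equality fails on a zero-dimensional space. *)
Lemma opnorm1 : opnorm (1%:M : op) <= 1.
Proof. by apply: opnorm_le => // v; rewrite mul1mx mul1r. Qed.

Lemma opnorm0 : opnorm (0 : op) = 0.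
Proof.
apply/eqP; rewrite eq_le opnorm_ge0 andbT.
by apply: opnorm_le => // v; rewrite mul0mx vnorm0 mul0r.
Qed.

Lemma opnorm_sum (I : finType) (P : pred I) (F : I -> op) :
  opnorm (\sum_(i | P i) F i) <= \sum_(i | P i) opnorm (F i).
Proof.
elim/big_rec2: _ => [|i y1 y2 _ IH]; first by rewrite opnorm0.
by apply: le_trans (opnormD _ _) _; rewrite lerD2l.
Qed.

(** In an orthonormal eigenbasis of [rho] the expectation is a convex combination of diagonal
    entries of [A], with the eigenvalues as weights. Each such entry is at most [opnorm A] by
    Cauchy-Schwarz. *)
Lemma normc_state_le (rho A : op) : density rho -> normc (state rho A) <= opnorm A.
Proof.
case=> rho_herm rho_ge0 rho_tr.
have rho_normal : rho \is normalmx by apply/normalmxP; rewrite rho_herm.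
have /orthomx_spectralP := rho_normal.
set P := spectralmx rho; set D := spectral_diag rho => rhoE.
have P_unitary : P \is unitarymx := spectral_unitarymx rho.
have PPt : P *m P ^t* = 1%:M := unitarymxP P_unitary.
rewrite invmx_unitary // in rhoE.
(* The eigenvectors of [rho], as columns of the adjoint of [P]. *)
pose v i : 'cV[C]_#|{: {ffun S -> 'I_q}}| := P ^t* *m delta_mx i ord0.
have vE i : (v i) ^t* = delta_mx ord0 i *m P.
  by rewrite /v trmx_mul map_mxM trmx_delta map_delta_mx trmxCK.
have v_norm i : vnorm (v i) = 1.
  apply/eqP; rewrite -(@eqrXn2 _ 2) ?vnorm_ge0 // expr1n -(inj_eq (@complexI R)).
  have -> : (vnorm (v i) ^+ 2)%:C = ((v i) ^t* *m v i) ord0 ord0.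
    rewrite vnorm_sqr rmorph_sum mxE; apply: eq_bigr => j _.
    by rewrite rmorphXn /= normcE normCK mulrC !mxE.
  by rewrite vE /v -mulmxA (mulmxA P) PPt mul1mx mul_delta_mx mxE !eqxx.
have dot_v (M : op) i : ((v i) ^t* *m M *m v i) ord0 ord0 = (P *m M *m P ^t*) i i.
  transitivity ((delta_mx ord0 i *m (P *m M *m P ^t*) *m delta_mx i ord0 : 'M_1) ord0 ord0).
    by rewrite vE /v !mulmxA.
  by rewrite -rowE -colE !mxE.
have D_ge0 i : 0 <= D ord0 i.
  have := rho_ge0 (v i); rewrite dot_v rhoE !mulmxA PPt mul1mx -mulmxA PPt mulmx1.
  by rewrite mxE eqxx mulr1n.
have D_sum : \sum_i D ord0 i = 1.
  by rewrite -rho_tr rhoE mxtrace_mulC mulmxA PPt mul1mx mxtrace_diag.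
rewrite /state rhoE -!mulmxA mxtrace_mulC -mulmxA.
have -> : \tr (diag_mx D *m (P *m A *m P ^t*)) =
          \sum_i D ord0 i * (P *m A *m P ^t*) i i.
  by apply: eq_bigr => i _; rewrite mul_diag_mx mxE.
rewrite -lecR; apply: (@le_trans _ _ (\sum_i D ord0 i * (opnorm A)%:C)).
  rewrite normcE; apply: le_trans (ler_norm_sum _ _ _) _.
  apply: ler_sum => i _; rewrite normrM (ger0_norm (D_ge0 i)) ler_wpM2l //.
  rewrite -dot_v -normcE lecR -mulmxA; apply: le_trans (normc_dot_le _ _) _.
  by rewrite v_norm mul1r; apply: le_trans (vnorm_mulmx _ _) _; rewrite v_norm mulr1.
by rewrite -mulr_suml D_sum mul1r.
Qed.

End Opnorm.

(** * The carre du champ *)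

Section CarreDuChamp.
Variables (R : realType) (q : nat) (S : finType).
Local Notation C := R[i].
Local Notation normc := (@Normc.normc R).
Local Notation op := (op R q S).
Implicit Types (G : lindblad R q S) (X Y Z T : op).

(** The adjoints of the jumps are listed separately because [Z] need not be self-adjoint. Such a [Z]
    behaves as a scalar for [lindblad_map G]. *)
Definition commutes_with G Z : Prop :=
  [/\ comm_mx Z (ham G),
      forall L, L \in jumps G -> comm_mx Z L
    & forall L, L \in jumps G -> comm_mx Z (L ^t*)].

Lemma lindblad_mapD G X Y :
  lindblad_map G (X + Y) = lindblad_map G X + lindblad_map G Y.
Proof.
rewrite /lindblad_map addrACA -scalerDr -big_split /=; congr (_ *: _ + _).
  by rewrite /comm mulmxDl mulmxDr opprD addrACA.
apply: eq_bigr => L _; rewrite mulmxDr mulmxDl /acomm mulmxDl (mulmxDr (L *m _)).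
by rewrite addrACA scalerDr opprD addrACA.
Qed.

Lemma lindblad_map_commutesl G Z X : commutes_with G Z ->
  lindblad_map G (Z *m X) = Z *m lindblad_map G X.
Proof.
case=> cH cL cLt; rewrite /lindblad_map mulmxDr -scalemxAr mulmx_sumr.
congr (_ *: _ + _).
  by rewrite /comm mulmxBr !mulmxA cH.
apply: eq_big_seq => L LG; rewrite mulmxBr -scalemxAr /acomm mulmxDr !mulmxA.
by rewrite (cL _ LG) -(mulmxA L Z (L ^t*)) (cLt _ LG) !mulmxA.
Qed.

Lemma lindblad_map_commutesr G Z X : commutes_with G Z ->
  lindblad_map G (X *m Z) = lindblad_map G X *m Z.
Proof.
case=> cH cL cLt; rewrite /lindblad_map mulmxDl -scalemxAl mulmx_suml.
congr (_ *: _ + _).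
  by rewrite /comm mulmxBl -!mulmxA cH.
apply: eq_big_seq => L LG; rewrite mulmxBl -scalemxAl /acomm mulmxDl -!mulmxA.
by rewrite -(cLt _ LG) (mulmxA Z L (L ^t*)) (cL _ LG) -!mulmxA.
Qed.

Lemma lindblad_map1 G : lindblad_map G 1%:M = 0.
Proof.
rewrite /lindblad_map /comm /acomm mulmx1 mul1mx subrr scaler0 add0r.
rewrite big1 // => L _; rewrite !mulmx1 mul1mx -mulr2n -[_ *m _ *+ 2]scaler_nat scalerA.
by rewrite mulVf ?pnatr_eq0 // scale1r subrr.
Qed.

Lemma lindblad_map_commutes G Z : commutes_with G Z -> lindblad_map G Z = 0.
Proof. by move=> cZ; rewrite -[Z]mulmx1 lindblad_map_commutesl // lindblad_map1 mulmx0. Qed.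

(** The carre du champ of a single generator, without an adjoint on [X] and without a factor one
    half. It measures how far the generator is from a derivation. *)
Definition gamma G X Y : op :=
  lindblad_map G (X *m Y) - lindblad_map G X *m Y - X *m lindblad_map G Y.

(** The contribution of [Z] is L(ZY) - L(Z)Y - Z L(Y), which vanishes since L(ZY) = Z L(Y) and L(Z)
    = 0. Thus [gamma G] sees its arguments only modulo operators commuting with [G]. *)
Lemma gamma_commutesl G X Z Y : commutes_with G Z -> gamma G (X + Z) Y = gamma G X Y.
Proof.
move=> cZ; have gXZ := lindblad_mapD G X Z.
have gXZY := lindblad_mapD G (X *m Y) (Z *m Y).
rewrite (lindblad_map_commutes cZ) in gXZ.
rewrite (lindblad_map_commutesl _ cZ) in gXZY.
rewrite /gamma [(X + Z) *m Y]mulmxDl gXZ gXZY.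
move: (lindblad_map G) => g.
by rewrite addr0 [(X + Z) *m _]mulmxDl [X *m _ + _]addrC opprD addrA [_ - Z *m _]addrAC addrK.
Qed.

Lemma gamma_commutesr G X Y Z : commutes_with G Z -> gamma G X (Y + Z) = gamma G X Y.
Proof.
move=> cZ; have gYZ := lindblad_mapD G Y Z.
have gXYZ := lindblad_mapD G (X *m Y) (X *m Z).
rewrite (lindblad_map_commutes cZ) in gYZ.
rewrite (lindblad_map_commutesr _ cZ) in gXYZ.
rewrite /gamma [X *m (Y + Z)]mulmxDr gYZ gXYZ.
move: (lindblad_map G) => g.
by rewrite addr0 [_ *m (Y + Z)]mulmxDr opprD [- _ - _ *m Z]addrC addrA addrK.
Qed.

Lemma gamma_commutes0l G Z Y : commutes_with G Z -> gamma G Z Y = 0.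
Proof.
move=> cZ; rewrite /gamma lindblad_map_commutesl // (lindblad_map_commutes cZ).
by rewrite mul0mx subr0 subrr.
Qed.

Lemma gamma_commutes0r G X Z : commutes_with G Z -> gamma G X Z = 0.
Proof.
move=> cZ; rewrite /gamma lindblad_map_commutesr // (lindblad_map_commutes cZ).
by rewrite mulmx0 subr0 subrr.
Qed.

Lemma commutes_withM G X Y :
  commutes_with G X -> commutes_with G Y -> commutes_with G (X *m Y).
Proof.
move=> [XH XL XLt] [YH YL YLt].
have aux Z : comm_mx X Z -> comm_mx Y Z -> comm_mx (X *m Y) Z.
  by rewrite /comm_mx => cX cY; rewrite -mulmxA cY !mulmxA cX.
by split=> [|L LG|L LG]; apply: aux; auto.
Qed.

Lemma commutes_withD G X Y :
  commutes_with G X -> commutes_with G Y -> commutes_with G (X + Y).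
Proof.
move=> [XH XL XLt] [YH YL YLt].
have aux Z : comm_mx X Z -> comm_mx Y Z -> comm_mx (X + Y) Z.
  by rewrite /comm_mx => cX cY; rewrite mulmxDl mulmxDr cX cY.
by split=> [|L LG|L LG]; apply: aux; auto.
Qed.

Lemma commutes_with_scalar G a : commutes_with G a%:M.
Proof. by split=> [|L _|L _]; rewrite /comm_mx mul_scalar_mx mul_mx_scalar. Qed.

Lemma commutes_with_sum G (I : finType) (P : pred I) (F : I -> op) :
  (forall i, P i -> commutes_with G (F i)) -> commutes_with G (\sum_(i | P i) F i).
Proof.
move=> cF; elim/big_rec: _ => [|i Z Pi cZ]; last by apply: commutes_withD; auto.
by split=> [|L _|L _]; rewrite /comm_mx mul0mx mulmx0.
Qed.

(** Since [W *m (T - Tx)] also commutes with [G], both occurrences of [T] can be localized at once.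
    This yields two small factors at sites far from [W]. *)
Lemma gamma_prod_commutesr G T Tx W : commutes_with G (T - Tx) ->
  commutes_with G W -> gamma G T (W *m T) = gamma G Tx (W *m Tx).
Proof.
move=> cT cW; rewrite -[in LHS](subrKC Tx T); move: (T - Tx) cT => D cD.
rewrite (gamma_commutesl _ _ cD) (mulmxDr W).
by rewrite (gamma_commutesr _ _ (commutes_withM cW cD)).
Qed.

Lemma gamma_prod_commutesl G T Tx W : commutes_with G (T - Tx) ->
  commutes_with G W -> gamma G (T *m W) T = gamma G (Tx *m W) Tx.
Proof.
move=> cT cW; rewrite -[in LHS](subrKC Tx T); move: (T - Tx) cT => D cD.
rewrite (gamma_commutesr _ _ cD) (mulmxDl _ _ W).
by rewrite (gamma_commutesl _ _ (commutes_withM cD cW)).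
Qed.

Lemma opnorm_gamma_le G b : 0 < b ->
  (forall A, opnorm (lindblad_map G A) <= b * opnorm A) ->
  forall X Y, opnorm (gamma G X Y) <= 3 * b * (opnorm X * opnorm Y).
Proof.
move=> /ltW b0 Gb X Y.
have h1 : opnorm (lindblad_map G (X *m Y)) <= b * (opnorm X * opnorm Y).
  by apply: le_trans (Gb _) _; rewrite ler_wpM2l ?opnormM.
have h2 : opnorm (lindblad_map G X *m Y) <= b * opnorm X * opnorm Y.
  by apply: le_trans (opnormM _ _) _; rewrite ler_wpM2r ?opnorm_ge0.
have h3 : opnorm (X *m lindblad_map G Y) <= opnorm X * (b * opnorm Y).
  by apply: le_trans (opnormM _ _) _; rewrite ler_wpM2l ?opnorm_ge0.
rewrite /gamma; apply: le_trans (opnormB _ _) _.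
apply: le_trans (lerD (opnormB _ _) (lexx _)) _.
apply: le_trans (lerD (lerD h1 h2) h3) _.
by move: (opnorm X) (opnorm Y) => x y; rewrite le_eqVlt; apply/orP; left; apply/eqP; ring.
Qed.

End CarreDuChamp.

(** * Reversibility in finite volume *)

Section FiniteVolume.
Variables (R : realType) (q : nat) (S : finType).
Local Notation C := R[i].
Local Notation normc := (@Normc.normc R).
Local Notation op := (op R q S).

Lemma stateB (rho X Y : op) : state rho (X - Y) = state rho X - state rho Y.
Proof. by rewrite /state mulmxBr linearB. Qed.

Variables (G : S -> lindblad R q S) (b : R).
Hypotheses (b_gt0 : 0 < b)
  (G_le : forall x A, opnorm (lindblad_map (G x) A) <= b * opnorm A).

(** For [S] the sites of a cube this is convertible to [liouvillian]. *)
Definition gen (A : op) : op := \sum_x lindblad_map (G x) A.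
Definition Gamma (X Y : op) : op := \sum_x gamma (G x) X Y.

Lemma GammaE X Y : Gamma X Y = gen (X *m Y) - gen X *m Y - X *m gen Y.
Proof. by rewrite /Gamma /gen mulmx_suml mulmx_sumr -!sumrB. Qed.

Lemma gen1 : gen 1%:M = 0.
Proof. by rewrite /gen big1 // => x _; rewrite lindblad_map1. Qed.

Section Reversibility.
Variable rho : op.
Hypothesis rev : reversible gen (state rho).

(** Stationarity is reversibility tested against the identity, which the generator kills. *)
Lemma state_gen X : state rho (gen X) = 0.
Proof. by rewrite -[gen X]mulmx1 -rev gen1 mulmx0 /state mulmx0 linear0. Qed.

(** In the expectation of [Gamma X Y], stationarity removes L(XY) and reversibility makes the two
    remaining terms equal. *)
Lemma state_mul_gen X Y : state rho (X *m gen Y) = - 2^-1 * state rho (Gamma X Y).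
Proof.
by rewrite GammaE !stateB state_gen -rev; field.
Qed.

Lemma state_gen_mul X Y : state rho (gen X *m Y) = - 2^-1 * state rho (Gamma X Y).
Proof. by rewrite -rev state_mul_gen. Qed.

Lemma reversibility_defect T A B :
  state rho (T *m (gen A *m B) *m T) - state rho (T *m (A *m gen B) *m T) =
  2^-1 * state rho (Gamma T (A *m B *m T)) - state rho (Gamma T A *m (B *m T))
  - 2^-1 * state rho (Gamma (T *m (A *m B)) T) + state rho (T *m A *m Gamma B T).
Proof.
have EA : state rho (Gamma T A *m (B *m T)) =
    state rho (gen (T *m A) *m (B *m T)) - state rho (gen T *m (A *m B *m T))
    - state rho (T *m (gen A *m B) *m T).
  rewrite GammaE; move: (gen (T *m A)) (gen T) (gen A) => u v w.
  by rewrite 2!mulmxBl 2!stateB !mulmxA.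
have EB : state rho (T *m A *m Gamma B T) =
    state rho (T *m A *m gen (B *m T)) - state rho (T *m (A *m gen B) *m T)
    - state rho (T *m (A *m B) *m gen T).
  rewrite GammaE; move: (gen (B *m T)) (gen T) (gen B) => u v w.
  by rewrite 2!mulmxBr 2!stateB !mulmxA.
(* The scalar identity behind the claim: [p] and [r] are the two expectations compared, [x] and [x']
   agree by reversibility for TA and BT, and [y] and [z], which contain L(T), become carre du champ
   terms. *)
have aux (p r ea eb x x' y z g1 g2 : C) : ea = x - y - p -> eb = x' - r - z ->
    z = - 2^-1 * g2 -> y = - 2^-1 * g1 -> x' = x ->
    p - r = 2^-1 * g1 - ea - 2^-1 * g2 + eb.
  by move=> -> -> -> -> ->; ring.
exact: aux EA EB (state_mul_gen _ _) (state_gen_mul _ _) (rev _ _).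
Qed.

End Reversibility.

(** * Norm estimates for an operator that is locally small up to a commuting remainder *)

Section Estimates.
Variables (T : op) (Tloc : S -> op) (eps tau : R).
Hypotheses (T_loc : forall x, commutes_with (G x) (T - Tloc x))
  (Tloc_le : forall x, opnorm (Tloc x) <= eps) (T_le : opnorm T <= tau).

Lemma TlocK x : T = Tloc x + (T - Tloc x).
Proof. by rewrite addrC subrK. Qed.

Let gle x := opnorm_gamma_le b_gt0 (G_le x).

Let b_ge0 : 0 <= b. Proof. exact: ltW. Qed.

Let b3_ge0 : 0 <= 3 * b.
Proof. by rewrite mulr_ge0 // ltW. Qed.

(** Only [Tloc x] contributes, which brings the factor [eps] in place of the norm of [T]. *)
Lemma opnorm_gammal_le x Y :
  opnorm (gamma (G x) T Y) <= 3 * b * eps * opnorm Y.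
Proof.
rewrite (TlocK x) gamma_commutesl //; apply: le_trans (gle _ _ _) _.
by rewrite -[leRHS]mulrA ler_wpM2l // ler_wpM2r // opnorm_ge0.
Qed.

Lemma opnorm_gammar_le x X :
  opnorm (gamma (G x) X T) <= 3 * b * eps * opnorm X.
Proof.
rewrite (TlocK x) gamma_commutesr //; apply: le_trans (gle _ _ _) _.
rewrite -[leRHS]mulrA ler_wpM2l // [leLHS]mulrC.
by rewrite ler_wpM2r // opnorm_ge0.
Qed.

(** The argument [x] matters: on an empty [S] no norm is bounded by [eps]. *)
Lemma eps_ge0 (x : S) : 0 <= eps.
Proof. exact: le_trans (opnorm_ge0 _) (Tloc_le x). Qed.

Section Local.
Variables (near : {set S}) (A : op) (a : R).
Hypotheses (A_far : forall x, x \notin near -> commutes_with (G x) A)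
  (A_le : opnorm A <= a).

(** Near sites are counted by [#|near|] and far ones crudely by all of [S], which is where [0 <= K']
    enters. *)
Let near_sum (F : S -> op) K K' : (forall x, x \in near -> opnorm (F x) <= K) ->
  (forall x, x \notin near -> opnorm (F x) <= K') -> 0 <= K' ->
  opnorm (\sum_x F x) <= #|near|%:R * K + #|S|%:R * K'.
Proof.
move=> FK FK' K'0; apply: le_trans (opnorm_sum _ _) _.
rewrite (bigID (mem near)) /=; apply: lerD.
  rewrite mulr_natl -sumr_const; exact: ler_sum.
apply: (@le_trans _ _ (\sum_(i | i \notin near) K')); first exact: ler_sum.
by rewrite sumr_const -[leLHS]mulr_natl ler_wpM2r // ler_nat max_card.
Qed.

Lemma opnorm_Gammal_local_le : opnorm (Gamma T A) <= #|near|%:R * (3 * b * eps * a).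
Proof.
apply: le_trans (near_sum (K := 3 * b * eps * a) (K' := 0) _ _ _) _ => //.
- move=> x _; apply: le_trans (opnorm_gammal_le _ _) _.
  by rewrite ler_wpM2l // mulr_ge0 // (eps_ge0 x).
- by move=> x /A_far cA; rewrite gamma_commutes0r // opnorm0.
- by rewrite mulr0 addr0.
Qed.

Lemma opnorm_Gammar_local_le : opnorm (Gamma A T) <= #|near|%:R * (3 * b * eps * a).
Proof.
apply: le_trans (near_sum (K := 3 * b * eps * a) (K' := 0) _ _ _) _ => //.
- move=> x _; apply: le_trans (opnorm_gammar_le _ _) _.
  by rewrite ler_wpM2l // mulr_ge0 // (eps_ge0 x).
- by move=> x /A_far cA; rewrite gamma_commutes0l // opnorm0.
- by rewrite mulr0 addr0.
Qed.

Let a_ge0 : 0 <= a. Proof. exact: le_trans (opnorm_ge0 _) A_le. Qed.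

Let tau_ge0 : 0 <= tau. Proof. exact: le_trans (opnorm_ge0 _) T_le. Qed.

(** A near site gives one factor [eps], the other [T] being bounded by [tau]. At a far site both
    copies of [T] are localized, and the resulting [eps ^+ 2] compensates the number of far sites
    when [eps] is of order 1/|S|. *)
Lemma opnorm_Gammal_prod_le : opnorm (Gamma T (A *m T)) <=
  #|near|%:R * (3 * b * eps * (a * tau)) + #|S|%:R * (3 * b * (eps * (a * eps))).
Proof.
apply: near_sum => [x _|x /A_far cA|].
- apply: le_trans (opnorm_gammal_le _ _) _.
  rewrite ler_wpM2l ?mulr_ge0 ?(eps_ge0 x) //.
  by apply: le_trans (opnormM _ _) _; rewrite ler_pM ?opnorm_ge0.
- rewrite (gamma_prod_commutesr (T_loc x) cA); apply: le_trans (gle _ _ _) _.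
  rewrite ler_wpM2l // ler_pM ?opnorm_ge0 //.
  by apply: le_trans (opnormM _ _) _; rewrite ler_pM ?opnorm_ge0.
(* No site is at hand, so the sign of [eps] is unknown; the product is rearranged to show its
   square. *)
- by rewrite mulr_ge0 // mulrCA mulr_ge0 // -expr2 sqr_ge0.
Qed.

Lemma opnorm_Gammar_prod_le : opnorm (Gamma (T *m A) T) <=
  #|near|%:R * (3 * b * eps * (a * tau)) + #|S|%:R * (3 * b * (eps * (a * eps))).
Proof.
apply: near_sum => [x _|x /A_far cA|].
- apply: le_trans (opnorm_gammar_le _ _) _.
  rewrite ler_wpM2l ?mulr_ge0 ?(eps_ge0 x) // mulrC.
  by apply: le_trans (opnormM _ _) _; rewrite ler_pM ?opnorm_ge0.
- rewrite (gamma_prod_commutesl (T_loc x) cA); apply: le_trans (gle _ _ _) _.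
  rewrite ler_wpM2l // mulrC ler_pM ?opnorm_ge0 // mulrC.
  by apply: le_trans (opnormM _ _) _; rewrite ler_pM ?opnorm_ge0.
- by rewrite mulr_ge0 // mulrCA mulr_ge0 // -expr2 sqr_ge0.
Qed.

End Local.

(** The four terms of [reversibility_defect] are bounded separately. The near part collects 3/2 + 3
    + 3/2 + 3 = 9, and the far part 3/2 + 3/2 = 3. *)
Lemma reversibility_defect_le rho (near : {set S}) A B (a c : R) :
  density rho -> reversible gen (state rho) ->
  (forall x, x \notin near -> commutes_with (G x) A) ->
  (forall x, x \notin near -> commutes_with (G x) B) ->
  opnorm A <= a -> opnorm B <= c ->
  normc (state rho (T *m (gen A *m B) *m T) - state rho (T *m (A *m gen B) *m T))
    <= 9 * (#|near|%:R * b * eps * tau * a * c) + 3 * (#|S|%:R * b * eps ^+ 2 * a * c).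
Proof.
move=> rho_d rev farA farB Aa Bc; rewrite reversibility_defect //.
have a0 : 0 <= a := le_trans (opnorm_ge0 _) Aa.
have c0 : 0 <= c := le_trans (opnorm_ge0 _) Bc.
have tau0 : 0 <= tau := le_trans (opnorm_ge0 _) T_le.
have ABac : opnorm (A *m B) <= a * c.
  by apply: le_trans (opnormM _ _) _; rewrite ler_pM ?opnorm_ge0.
have farAB x : x \notin near -> commutes_with (G x) (A *m B).
  by move=> xn; apply: commutes_withM; auto.
have st X : normc (state rho X) <= opnorm X by apply: normc_state_le.
have half X : normc (2^-1 * state rho X) <= 2^-1 * opnorm X.
  rewrite Normc.normcM; have -> : normc (2^-1) = 2^-1.
    apply: (@complexI R); rewrite normcE ger0_norm ?invr_ge0 ?ler0n //.
    by rewrite fmorphV rmorph_nat.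
  by rewrite ler_wpM2l ?invr_ge0 ?ler0n.
have nD (z w : C) : normc (z + w) <= normc z + normc w.
  by rewrite -lecR rmorphD; exact: (@ler_normD C C).
have nN (z : C) : normc (- z) = normc z.
  by apply: (@complexI R); rewrite !normcE normrN.
have half0 : 0 <= 2^-1 :> R by rewrite invr_ge0 ler0n.
have e1 := le_trans (half _) (ler_wpM2l half0 (opnorm_Gammal_prod_le farAB ABac)).
have e3 := le_trans (half _) (ler_wpM2l half0 (opnorm_Gammar_prod_le farAB ABac)).
have e2 : normc (state rho (Gamma T A *m (B *m T))) <=
    #|near|%:R * (3 * b * eps * a) * (c * tau).
  apply: le_trans (st _) _; apply: le_trans (opnormM _ _) _.
  rewrite ler_pM ?opnorm_ge0 ?opnorm_Gammal_local_le //.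
  by apply: le_trans (opnormM _ _) _; rewrite ler_pM ?opnorm_ge0.
have e4 : normc (state rho (T *m A *m Gamma B T)) <=
    (tau * a) * (#|near|%:R * (3 * b * eps * c)).
  apply: le_trans (st _) _; apply: le_trans (opnormM _ _) _.
  rewrite ler_pM ?opnorm_ge0 ?opnorm_Gammar_local_le //.
  by apply: le_trans (opnormM _ _) _; rewrite ler_pM ?opnorm_ge0.
apply: le_trans (nD _ _) _; apply: le_trans (lerD (nD _ _) e4) _.
apply: le_trans (lerD (lerD (nD _ _) (lexx _)) (lexx _)) _.
rewrite !nN; apply: le_trans (lerD (lerD (lerD e1 e2) e3) (lexx _)) _.
by rewrite le_eqVlt; apply/orP; left; apply/eqP; field.
Qed.

End Estimates.
End FiniteVolume.

(** * Operators acting on some of the tensor factors *)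

Section Lift.
Variables (R : realType) (q : nat).
Local Notation C := R[i].
Local Notation normc := (@Normc.normc R).
Local Notation op S := (op R q S).
Local Notation config S := {ffun S -> 'I_q}.

Definition agree_off (S T : finType) (f : T -> S) (u v : config S) : bool :=
  [forall y, (y \notin codom f) ==> (u y == v y)].

Lemma agree_offP (S T : finType) (f : T -> S) (u v : config S) :
  reflect (forall y, y \notin codom f -> u y = v y) (agree_off f u v).
Proof.
apply: (iffP forallP) => [h y yf|h y]; first by apply/eqP; have /implyP := h y; apply.
by apply/implyP => /h ->.
Qed.

Lemma agree_off_sym (S T : finType) (f : T -> S) (u v : config S) :
  agree_off f u v = agree_off f v u.
Proof. by apply: eq_forallb => y; rewrite eq_sym. Qed.

Definition pull (S T : finType) (f : T -> S) (u : config S) : config T :=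
  [ffun x => u (f x)].

Lemma pull_agree_off_inj (S T : finType) (f : T -> S) (u v : config S) :
  agree_off f u v -> pull f u = pull f v -> u = v.
Proof.
move=> /agree_offP uv /ffunP puv; apply/ffunP => y.
have [/codomP[x ->]|/uv //] := boolP (y \in codom f).
by have := puv x; rewrite !ffunE.
Qed.

Lemma lift_opE (S T : finType) (f : T -> S) (a : op T) (i j : 'I_#|{: config S}|) :
  lift_op f a i j =
  if agree_off f (enum_val i) (enum_val j)
  then a (enum_rank (pull f (enum_val i))) (enum_rank (pull f (enum_val j))) else 0.
Proof. by rewrite mxE. Qed.

Lemma lift_op_adjoint (S T : finType) (f : T -> S) (a : op T) :
  (lift_op f a) ^t* = lift_op f (a ^t*).
Proof.
apply/matrixP => i j; rewrite [RHS]lift_opE [LHS]mxE [_^T _ _]mxE lift_opE.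
by rewrite agree_off_sym; case: ifP => _; rewrite ?rmorph0 // !mxE.
Qed.

(** Makes the identity a local operator, as needed to deduce metastability. *)
Lemma lift_op1 (S T : finType) (f : T -> S) : lift_op f (1%:M : op T) = 1%:M.
Proof.
apply/matrixP => i j; rewrite lift_opE !mxE.
have [->|ij] := eqVneq i j.
  by rewrite eqxx; case: agree_offP => // -[].
case: ifP => // uv; rewrite (inj_eq enum_rank_inj).
case: eqVneq => // /(pull_agree_off_inj uv)/enum_val_inj /eqP.
by rewrite (negPf ij).
Qed.

(** With disjoint images, a single intermediate configuration can contribute to the matrix product,
    so the entry factorizes. The result is symmetric under exchange of the two factors, which is why
    they commute. *)
Lemma lift_op_mulE (S T U : finType) (f : T -> S) (g : U -> S) (a : op T) (b : op U)
    (i j : 'I_#|{: config S}|) :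
  (forall x y, f x != g y) ->
  (lift_op f a *m lift_op g b) i j =
  let u := enum_val i in let v := enum_val j in
  if [forall y, (y \notin codom f) && (y \notin codom g) ==> (u y == v y)]
  then a (enum_rank (pull f u)) (enum_rank (pull f v)) *
       b (enum_rank (pull g u)) (enum_rank (pull g v)) else 0.
Proof.
move=> fg; set u := enum_val i; set v := enum_val j => /=.
have gf y : y \in codom f -> y \notin codom g.
  by move=> /codomP[x ->]; apply/negP => /codomP[z] /eqP; rewrite (negPf (fg _ _)).
(* The intermediate configuration: the first factor has already changed [u] into [v] on the image of
   [f], and nothing else has moved. *)
pose w : config S := [ffun y => if y \in codom f then v y else u y].
have mid k : agree_off f u (enum_val k) -> agree_off g (enum_val k) v ->
    k = enum_rank w.
  move=> /agree_offP uk /agree_offP kv; apply: (can_inj enum_valK).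
  rewrite enum_rankK; apply/ffunP => y; rewrite ffunE.
  by case: ifPn => [/gf/kv //|/uk ->].
rewrite mxE; have [|nuv] := ifPn; last first.
  rewrite big1 // => k _; rewrite !lift_opE -/u -/v.
  case: ifP => [uk|]; last by rewrite mul0r.
  case: ifP => [kv|]; last by rewrite mulr0.
  case/negP: nuv; apply/forallP => y; apply/implyP => /andP[yf yg].
  by rewrite (agree_offP _ _ _ uk) // (agree_offP _ _ _ kv).
move=> /forallP uv; rewrite (bigD1 (enum_rank w)) //= big1 ?addr0; last first.
  move=> k kw; rewrite !lift_opE -/u -/v.
  case: ifP => [uk|]; last by rewrite mul0r.
  case: ifP => [kv|]; last by rewrite mulr0.
  by rewrite (mid _ uk kv) eqxx in kw.
rewrite !lift_opE enum_rankK -/u -/v.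
have -> : agree_off f u w.
  by apply/agree_offP => y yf; rewrite ffunE (negPf yf).
have -> : agree_off g w v.
  apply/agree_offP => y yg; rewrite ffunE; case: ifPn => // yf.
  by apply/eqP; have := uv y; rewrite yf yg.
have -> : pull f w = pull f v by apply/ffunP => x; rewrite !ffunE codom_f.
have -> // : pull g w = pull g u.
apply/ffunP => x; rewrite !ffunE; case: ifPn => // /gf.
by rewrite codom_f.
Qed.

Lemma lift_op_comm (S T U : finType) (f : T -> S) (g : U -> S) (a : op T) (b : op U) :
  (forall x y, f x != g y) -> comm_mx (lift_op f a) (lift_op g b).
Proof.
move=> fg; have gf x y : g x != f y by rewrite eq_sym.
apply/matrixP => i j; rewrite lift_op_mulE // lift_op_mulE //= mulrC.
by under eq_forallb do rewrite andbC.
Qed.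

(** A crude bound that depends only on [a] and its own tensor factors, hence is uniform in the
    volume. *)
Definition lift_bound (T : finType) (a : op T) : R :=
  #|{: config T}|%:R * \sum_i \sum_j normc (a i j).

Lemma opnorm_lift_op_le (S T : finType) (f : T -> S) (a : op T) :
  opnorm (lift_op f a) <= lift_bound a.
Proof.
have m0 : 0 <= \sum_i \sum_j normc (a i j).
  by do 2!apply: sumr_ge0 => ? _; rewrite normc_ge0.
apply: opnorm_le => [v|]; last by rewrite mulr_ge0.
pose e (i j : 'I_#|{: config S}|) := agree_off f (enum_val i) (enum_val j).
apply: (@vnorm_sparse R _ e) => //.
- by move=> i j; rewrite /e agree_off_sym.
(* A row has at most as many nonzero entries as there are configurations on [T]: off the image of
   [f] the column index is forced, so [pull f] is injective on these columns. *)
- move=> i; pose h (j : 'I_#|{: config S}|) := pull f (enum_val j).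
  rewrite -(@card_in_imset _ _ h) ?max_card // => j k.
  rewrite !inE /e => ij ik hjk; apply: enum_val_inj.
  apply: (pull_agree_off_inj (f := f)) => //; apply/agree_offP => y yf.
  by rewrite -(agree_offP _ _ _ ij) // -(agree_offP _ _ _ ik).
- by move=> i j /negPf nij; rewrite lift_opE -/(e i j) nij.
- move=> i j; rewrite lift_opE; case: ifP => _; last by rewrite Normc.normc0.
  rewrite (bigD1 (enum_rank (pull f (enum_val i)))) //=.
  rewrite (bigD1 (enum_rank (pull f (enum_val j)))) //= -addrA lerDl addr_ge0 //.
    by apply: sumr_ge0 => ? _; rewrite normc_ge0.
  by do 2!apply: sumr_ge0 => ? _; rewrite normc_ge0.
Qed.

(** Operators on disjoint sets of tensor factors commute, and taking adjoints preserves supports. *)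
Lemma lift_op_commutes_with (S T : finType) (G : lindblad R q S) (B : {set S})
    (f : T -> S) (a : op T) :
  supported B (ham G) -> (forall L, L \in jumps G -> supported B L) ->
  (forall x, f x \notin B) -> commutes_with G (lift_op f a).
Proof.
move=> suppH suppL fB.
have comm_supp Z : supported B Z -> comm_mx (lift_op f a) Z.
  case=> z ->; apply: lift_op_comm => x y; apply/eqP => fxy.
  by have := fB x; rewrite fxy (valP y).
split=> [|L LG|L LG]; apply: comm_supp; auto.
by case: (suppL _ LG) => l ->; exists (l ^t*); rewrite lift_op_adjoint.
Qed.

End Lift.

(** * Counting sites of the torus *)

Section Torus.
Variables (d : nat) (Lam : cube d).
Implicit Types (x y z : site Lam) (r : nat).

Lemma torus_dist_sym x y : torus_dist x y = torus_dist y x.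
Proof. by apply: eq_bigr => i _; rewrite addnC. Qed.

Lemma mem_ball_sym x y r : (x \in ball_site y r) = (y \in ball_site x r).
Proof. by rewrite !inE torus_dist_sym. Qed.

(** One coordinate of [torus_dist]: subtraction is truncated, so one of the two differences is 0 and
    [k] is the absolute difference. *)
Definition circle_ball n (a : 'I_n) r : pred 'I_n :=
  fun t => let k := ((a - t) + (t - a))%N in (minn k (n - k) <= r)%N.

Lemma card_circle_ball n (a : 'I_n) r : (#|circle_ball a r| <= (4 * r).+1)%N.
Proof.
(* An interval around [a], and the two ends of the circle that can be reached by wrapping around. *)
pose l := iota (a - r) (2 * r).+1 ++ iota 0 r ++ iota (n - r) r.
have -> : ((4 * r).+1 = size l)%N by rewrite !size_cat !size_iota; lia.
rewrite cardE -(size_map val); apply: uniq_leq_size.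
  by rewrite (map_inj_uniq val_inj) enum_uniq.
move=> _ /mapP[t + ->]; rewrite mem_enum inE /circle_ball /= => tr.
rewrite !mem_cat !mem_iota; have := ltn_ord t; have := ltn_ord a.
by move: tr; rewrite /=; lia.
Qed.

(** The ball lies in a product of one-dimensional balls; what matters is a bound independent of the
    cube. *)
Lemma card_ball_site x r : (#|ball_site x r| <= (4 * r).+1 ^ d)%N.
Proof.
have sub : ball_site x r \subset family (fun i => circle_ball (x i) r).
  apply/fintype.subsetP => y; rewrite inE => xy; apply/familyP => i; rewrite unfold_in.
  by apply: leq_trans xy; rewrite /torus_dist (bigD1 i) //= leq_addr.
apply: leq_trans (subset_leq_card sub) _.
rewrite card_family foldrE big_map big_enum /=.
apply: (@leq_trans (\prod_(i < d) (4 * r).+1)%N).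
  by apply: leq_prod => i _; apply: card_circle_ball.
by rewrite prod_nat_const card_ord.
Qed.

Definition thicken (Y : {set site Lam}) r : {set site Lam} :=
  \bigcup_(z in Y) ball_site z r.

Lemma card_thicken Y r : (#|thicken Y r| <= #|Y| * (4 * r).+1 ^ d)%N.
Proof.
rewrite -sum_nat_const /thicken; elim/big_rec2: _ => [|z n A _ An].
  by rewrite cards0.
by apply: leq_trans (leq_card_setU _ _) _; rewrite leq_add ?card_ball_site.
Qed.

Lemma thickenPn Y r x : x \notin thicken Y r -> forall z, z \in Y -> z \notin ball_site x r.
Proof.
move=> xY z zY; apply: contra xY => zx; apply/finset.bigcupP; exists z => //.
by rewrite mem_ball_sym.
Qed.

End Torus.

Lemma side_to_Zd d n : (0 < d)%N -> \forall Lam \near to_Zd d, (n < side Lam)%N.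
Proof.
(* A cube containing both the origin and the point (n, ..., n) has side larger than [n]; a positive
   dimension provides a coordinate to read this off. *)
move=> d_gt0; exists [fset ([ffun=> 0 : int] : Zd d); [ffun=> n%:Z]]%fset => // Lam h.
have := h [ffun=> 0 : int]; have := h [ffun=> n%:Z]; rewrite !inE !eqxx /= ?orbT.
move=> /(_ isT)/forallP/(_ (Ordinal d_gt0))/andP[_ hn].
move=> /(_ isT)/forallP/(_ (Ordinal d_gt0))/andP[h0 _].
move: hn h0; rewrite !ffunE => hn h0.
rewrite -ltz_nat; apply: lt_le_trans hn _.
by rewrite -[leRHS]add0r lerD2r.
Qed.

Lemma leq_side_card d (Lam : cube d) : (0 < d)%N -> (side Lam <= #|{: site Lam}|)%N.
Proof.
case: d Lam => // d Lam _; rewrite card_ffun !card_ord.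
by rewrite -{1}(expn1 (side Lam)) leq_pexp2l // side_gt0.
Qed.

(** * Uniform bounds along the family of cubes *)

Section Tilde.
Variables (R : realType) (q : nat) (S : finType).
Local Notation C := R[i].
Local Notation normc := (@Normc.normc R).
Local Notation op := (op R q S).

Lemma tilde_opE (rho O : op) s :
  tilde_op rho O s = ((sqrtC 2)^-1)%:M +
    ((sqrtC 2)^-1 * (s / sqrtC (state rho (O *m O)))) *: O.
Proof. by rewrite /tilde_op scalerDr scalerA scalemx1. Qed.

Lemma normc_inv_sqrtC2 : normc (sqrtC 2)^-1 <= 1.
Proof.
rewrite -lecR normcE normfV ger0_norm ?sqrtC_ge0 ?ler0n //.
rewrite invf_le1 ?sqrtC_gt0 ?ltr0n //.
by rewrite -[leLHS]sqrtC1 ler_sqrtC ?nnegrE ?ler0n // ler1n.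
Qed.

(** The complex order makes the hypothesis include that the second moment is real, so its square
    root is real and at least [nu]. With [nu] of order |Lambda| the coefficient of O is of order
    1/|Lambda|. *)
Lemma normc_tilde_coef (rho O : op) s (nu : R) : 0 < nu -> normc s = 1 ->
  (nu ^+ 2)%:C <= state rho (O *m O) ->
  normc ((sqrtC 2)^-1 * (s / sqrtC (state rho (O *m O)))) <= nu^-1.
Proof.
move=> nu0 s1; set w := state rho _ => nuw.
have nu_le : nu%:C <= sqrtC w.
  have -> : nu%:C = sqrtC ((nu ^+ 2)%:C).
    by rewrite rmorphXn sqrCK // ler0c ltW.
  have h0 : 0 <= (nu ^+ 2)%:C :> C by rewrite ler0c sqr_ge0.
  by rewrite ler_sqrtC ?nnegrE // (le_trans h0).
have nu_leR : nu <= normc (sqrtC w).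
  rewrite -lecR normcE; apply: (le_trans nu_le (real_ler_norm _)).
  by apply: ger0_real; apply: le_trans nu_le; rewrite ler0c ltW.
rewrite Normc.normcM Normc.normcM s1 mul1r (Normc.normcV (sqrtC w)).
rewrite -[leRHS]mul1r ler_pM ?normc_ge0 ?invr_ge0 ?normc_ge0 ?normc_inv_sqrtC2 //.
by rewrite lef_pV2 ?posrE // (lt_le_trans nu0).
Qed.

End Tilde.

Section Families.
Variables (R : realType) (d q : nat).
Local Notation normc := (@Normc.normc R).
Variables (G : forall Lam : cube d, site Lam -> lindblad R q (site Lam))
  (rho : forall Lam : cube d, op R q (site Lam))
  (o : forall Lam : cube d, site Lam -> op R q (site Lam)).

(** In a cube not containing [X], points may be identified, but there are still at most [#|X|]
    sites. The estimates thus hold for every cube and not only eventually. *)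
Definition image_sites (X : {fset Zd d}) (Lam : cube d) : {set site Lam} :=
  [set to_site Lam (val x) | x : X].

Lemma local_op_commutes_with r (X : {fset Zd d}) (a : op R q X) (Lam : cube d) x :
  supported (ball_site x r) (ham (G x)) ->
  (forall L, L \in jumps (G x) -> supported (ball_site x r) L) ->
  x \notin thicken (image_sites X Lam) r ->
  commutes_with (G x) (local_op a Lam).
Proof.
move=> sH sL /thickenPn xX; apply: lift_op_commutes_with sH sL _ => y.
by apply: xX; apply: imset_f.
Qed.

(** The finite-volume estimate is applied with [eps] equal to [e / n], where [n] is the volume and
    [e] does not depend on the cube. *)
Lemma tilde_defect_le (mu : R) (s : R[i]) (X Y : {fset Zd d}) (a : op R q X) (b : op R q Y) :
  strictly_local G -> uniformly_bounded G ->
  (forall Lam, density (rho Lam)) ->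
  (forall Lam, reversible (liouvillian G Lam) (state (rho Lam))) ->
  extensive o -> 0 < mu ->
  (forall Lam, ((2^-1 * mu * #|{: site Lam}|%:R) ^+ 2)%:C
     <= state (rho Lam) (extensive_sum o Lam *m extensive_sum o Lam)) ->
  normc s = 1 ->
  exists D : R, forall Lam : cube d,
    normc (tilde_state (rho Lam) (extensive_sum o Lam) s
             (liouvillian G Lam (local_op a Lam) *m local_op b Lam)
         - tilde_state (rho Lam) (extensive_sum o Lam) s
             (local_op a Lam *m liouvillian G Lam (local_op b Lam)))
    <= D / #|{: site Lam}|%:R.
Proof.
move=> [r G_loc] [bd bd0 G_le] rho_d rev [r0 [c o_loc]] mu0 lro s1.
(* [K0] bounds the number of terms of O that can meet the ball where one generator acts, and [K] the
   number of generators that can meet the supports of the two local operators. *)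
pose K0 := ((4 * r).+1 ^ d * (4 * r0).+1 ^ d)%N.
pose K := ((#|{: X}| + #|{: Y}|) * (4 * r).+1 ^ d)%N.
(* The factor [2 / mu] is the coefficient of O up to [n^-1]. In [tau], the summand 1 bounds the
   scalar part and the other one uses that O has norm at most [n * |c|]. The absolute value is taken
   because the sign of [c] is not prescribed. *)
pose e := K0%:R * `|c| * (2 / mu).
pose tau := 1 + `|c| * (2 / mu).
pose la := lift_bound a; pose lb := lift_bound b.
exists (9 * (K%:R * bd * e * tau * la * lb) + 3 * (bd * e ^+ 2 * la * lb)) => Lam.
have n0 : 0 < #|{: site Lam}|%:R :> R.
  rewrite ltr0n; apply/card_gt0P.
  by exists [ffun i => Ordinal (side_gt0 Lam)].
set n : R := #|{: site Lam}|%:R in n0 *.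
set O := extensive_sum o Lam.
pose be := (sqrtC 2)^-1 * (s / sqrtC (state (rho Lam) (O *m O))).
have nu0 : 0 < 2^-1 * mu * n by apply: mulr_gt0 n0; apply: mulr_gt0 mu0; rewrite invr_gt0 ltr0n.
have be_le : normc be <= (2 / mu) / n.
  have := normc_tilde_coef nu0 s1 (lro Lam).
  by rewrite !invfM invrK.
have o_le (x : site Lam) : opnorm (o x) <= `|c|.
  exact: (le_trans (o_loc Lam x).2 (ler_norm c)).
have near_o (x : site Lam) : (#|thicken (ball_site x r) r0| <= K0)%N.
  by apply: leq_trans (card_thicken _ _) _; rewrite leq_mul ?card_ball_site.
(* The terms of O within reach of the generator at [x]; the rest of T is a scalar plus terms
   supported away from its ball. *)
pose Tloc (x : site Lam) := be *: \sum_(y in thicken (ball_site x r) r0) o y.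
have G_loc1 (x : site Lam) : supported (ball_site x r) (ham (G x)) by exact: (G_loc Lam x).1.
have G_loc2 (x : site Lam) L : L \in jumps (G x) -> supported (ball_site x r) L.
  exact: (G_loc Lam x).2.
set T := tilde_op (rho Lam) O s.
have T_loc x : commutes_with (G x) (T - Tloc x).
  rewrite /T tilde_opE -addrA; apply: commutes_withD.
    exact: commutes_with_scalar.
  rewrite /Tloc -/be -scalerBr /O /extensive_sum.
  rewrite (bigID (mem (thicken (ball_site x r) r0))) /= [X in X - _]addrC addrK.
  rewrite -mul_scalar_mx; apply: commutes_withM; first exact: commutes_with_scalar.
  apply: commutes_with_sum => y /thickenPn yx.
  have [[oy ->] _] := o_loc Lam y.
  apply: lift_op_commutes_with (G_loc1 x) (G_loc2 x) _ => z.
  by apply/negP => /yx; rewrite (valP z).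
have Tloc_le x : opnorm (Tloc x) <= e / n.
  apply: le_trans (opnormZ_le _ _) _.
  have -> : e / n = (2 / mu) / n * (K0%:R * `|c|) by rewrite /e; ring.
  rewrite ler_pM ?normc_ge0 ?opnorm_ge0 //.
  apply: le_trans (opnorm_sum _ _) _.
  apply: (@le_trans _ _ (\sum_(y in thicken (ball_site x r) r0) `|c|)).
    exact: ler_sum.
  by rewrite sumr_const -[leLHS]mulr_natl ler_wpM2r // ler_nat.
have T_le : opnorm T <= tau.
  rewrite /T tilde_opE; apply: le_trans (opnormD _ _) _; apply: lerD.
    rewrite -scalemx1; apply: le_trans (opnormZ_le _ _) _.
    by rewrite -[leRHS]mulr1 ler_pM ?normc_ge0 ?opnorm_ge0 ?normc_inv_sqrtC2 ?opnorm1.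
  apply: le_trans (opnormZ_le _ _) _.
  have -> : `|c| * (2 / mu) = (2 / mu) / n * (n * `|c|) by field; rewrite ?lt0r_neq0.
  rewrite ler_pM ?normc_ge0 ?opnorm_ge0 //.
  apply: le_trans (opnorm_sum _ _) _.
  apply: (@le_trans _ _ (\sum_(y : site Lam) `|c|)); first exact: ler_sum.
  by rewrite sumr_const -[leLHS]mulr_natl.
pose near := thicken (image_sites X Lam) r :|: thicken (image_sites Y Lam) r.
have near_le : (#|near| <= K)%N.
  apply: leq_trans (leq_card_setU _ _) _; rewrite /K mulnDl leq_add //.
    by apply: leq_trans (card_thicken _ _) _; rewrite leq_mul // leq_imset_card.
  by apply: leq_trans (card_thicken _ _) _; rewrite leq_mul // leq_imset_card.
have farA x : x \notin near -> commutes_with (G x) (local_op a Lam).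
  rewrite finset.in_setU negb_or => /andP[xX _].
  exact: local_op_commutes_with (G_loc1 x) (G_loc2 x) xX.
have farB x : x \notin near -> commutes_with (G x) (local_op b Lam).
  rewrite finset.in_setU negb_or => /andP[_ xY].
  exact: local_op_commutes_with (G_loc1 x) (G_loc2 x) xY.
have := reversibility_defect_le bd0 (G_le Lam) T_loc Tloc_le T_le (rho_d Lam)
  (rev Lam) farA farB (opnorm_lift_op_le _ _) (opnorm_lift_op_le _ _).
move/le_trans; apply.
have la0 : 0 <= la.
  exact: (le_trans (opnorm_ge0 (local_op a Lam)) (opnorm_lift_op_le _ _)).
have lb0 : 0 <= lb.
  exact: (le_trans (opnorm_ge0 (local_op b Lam)) (opnorm_lift_op_le _ _)).
have tau0 : 0 <= tau := le_trans (opnorm_ge0 _) T_le.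
(* The sign is read off at the corner of the cube, a site that always exists. *)
have en0 : 0 <= e / n.
  exact: (le_trans (opnorm_ge0 _) (Tloc_le [ffun i => Ordinal (side_gt0 Lam)])).
have ge0 : 0 <= bd * (e / n) * tau * la * lb.
  by apply: mulr_ge0 lb0; apply: mulr_ge0 la0; apply: mulr_ge0 tau0;
  apply: mulr_ge0 en0; apply: ltW.
rewrite -/la -/lb -/n.
apply: (@le_trans _ _ (9 * (K%:R * bd * (e / n) * tau * la * lb) +
                       3 * (n * bd * (e / n) ^+ 2 * la * lb))).
  rewrite lerD2r ler_wpM2l //.
  have fact (k : R) : k * bd * (e / n) * tau * la * lb =
      k * (bd * (e / n) * tau * la * lb) by rewrite !mulrA.
  by rewrite !fact ler_wpM2r ?ler_nat.
(* In the far part, [n * (e / n) ^+ 2] equals [e ^+ 2 / n], so both parts are exactly of order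
   [n^-1]. *)
rewrite le_eqVlt; apply/orP; left; apply/eqP; field.
by rewrite lt0r_neq0.
Qed.

(** * The infinite-volume limit *)

Lemma cvg0_le_inv_card (f : cube d -> R) (D : R) : (0 < d)%N ->
  (forall Lam, 0 <= f Lam) -> (forall Lam, f Lam <= D / #|{: site Lam}|%:R) ->
  f Lam @[Lam --> to_Zd d] --> (0 : R).
Proof.
move=> d_gt0 f0 fD; apply/cvgrPdist_lt => e e0.
(* Once the side exceeds an integer above [|D| / e], so does the volume, and the bound drops below
   [e]. *)
apply: filterS (side_to_Zd (Num.bound (`|D| / e)) d_gt0) => Lam side_gt.
rewrite sub0r normrN ger0_norm //; apply: le_lt_trans (fD Lam) _.
have n_gt : (Num.bound (`|D| / e) < #|{: site Lam}|)%N.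
  exact: leq_trans side_gt (leq_side_card Lam d_gt0).
rewrite ltr_pdivrMr ?ltr0n; last exact: leq_ltn_trans n_gt.
apply: le_lt_trans (ler_norm D) _.
rewrite mulrC -ltr_pdivrMr //; apply: lt_trans (archi_boundP _) _.
  by rewrite divr_ge0 // ltW.
by rewrite ltr_nat.
Qed.

(** Taking B to be the identity, on the same support as A, leaves only the expectation of L(A),
    since L(1) = 0. *)
Lemma asymptotically_reversible_metastable
    (phi : forall Lam : cube d, op R q (site Lam) -> R[i]) :
  (forall Lam, phi Lam 0 = 0) ->
  asymptotically_reversible (liouvillian G) phi -> metastable (liouvillian G) phi.
Proof.
move=> phi0 arev X a; have := arev X X a 1%:M.
rewrite /local_op; under eq_fun do rewrite lift_op1 mulmx1.
under eq_fun do rewrite [liouvillian G _ 1%:M]gen1 mulmx0 phi0 subr0.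
exact.
Qed.

End Families.

Theorem theorem3 (R : realType) (d q : nat) (d_gt0 : (0 < d)%N)
  (G : forall Lam : cube d, site Lam -> lindblad R q (site Lam))
  (rho : forall Lam : cube d, op R q (site Lam))
  (o : forall Lam : cube d, site Lam -> op R q (site Lam))
  (mu : R)
  (G_local : strictly_local G)
  (G_bounded : uniformly_bounded G)
  (rho_state : forall Lam, density (rho Lam))
  (G_reversible :
     forall Lam, reversible (liouvillian G Lam) (state (rho Lam)))
  (o_extensive : extensive o)
  (O_selfadjoint : forall Lam, (extensive_sum o Lam) ^t* = extensive_sum o Lam)
  (mu_gt0 : 0 < mu)
  (long_range_order : forall Lam,
     ((2^-1 * mu * #|{: site Lam}|%:R) ^+ 2)%:C
       <= state (rho Lam) (extensive_sum o Lam *m extensive_sum o Lam)) :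
  let omega (s : R[i]) (Lam : cube d) :=
    tilde_state (rho Lam) (extensive_sum o Lam) s in
  [/\ asymptotically_reversible (liouvillian G) (omega 1),
      asymptotically_reversible (liouvillian G) (omega (-1)),
      metastable (liouvillian G) (omega 1)
    & metastable (liouvillian G) (omega (-1))].
Proof.
move=> omega.
(* Both signs are treated at once: only the modulus of [s] enters the estimate. *)
have arev s : Normc.normc s = 1 -> asymptotically_reversible (liouvillian G) (omega s).
  move=> s1 X Y a b.
  have [D Dle] := tilde_defect_le a b G_local G_bounded rho_state G_reversible
    o_extensive mu_gt0 long_range_order s1.
  by apply: cvg0_le_inv_card d_gt0 _ Dle => Lam; apply: normc_ge0.
have omega0 s Lam : omega s Lam 0 = 0.
  by rewrite /omega /tilde_state /state mulmx0 mul0mx mulmx0 linear0.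
have n1 : Normc.normc (1 : R[i]) = 1 by apply: Normc.normc1.
have nN1 : Normc.normc (-1 : R[i]) = 1.
  by apply: (@complexI R); rewrite normcE normrN1.
split; [exact: arev n1|exact: arev nN1| |].
- exact: asymptotically_reversible_metastable (omega0 1) (arev _ n1).
- exact: asymptotically_reversible_metastable (omega0 (-1)) (arev _ nN1).
Qed.
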